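(* Let $(X,X^+)=(\mathbb{R}^n,\mathbb{R}^n_+)$ for some $n\in\mathbb{N}$, where $\mathbb{R}^n$ is equipped with the maximum norm $\|\cdot\|$ and $\mathbb{R}^n_+$ denotes the standard positive cone. Let $A:\mathbb{R}^n_+\to\mathbb{R}^n_+$ be continuous and monotone. Then the following statements are equivalent: (i) The system $x(k+1)\le A(x(k))+u(k)$, $k\in\mathbb{Z}_+$, has the MLIM property. (ii) The operator $\mathrm{id}-A$ has the MBI property. (iii) The uniform small-gain condition holds: there is $\eta\in\mathcal{K}_\infty$ such that $\mathrm{dist}(A(x)-x,X^+)\ge\eta(\|x\|)$ for all $x\in X^+$. (iv) There is $\eta\in\mathcal{K}_\infty$ such that $A(x)\not\ge x-\eta(\|x\|)\mathbf{1}$ for all $x\in X^+\setminus\{0\}$. Additionally, if $A$ is either $\Gamma_\boxplus$ or $\Gamma_\otimes$, then the conditions (i), (ii), (iii) and (iv) are equivalent to each of: (v) $A$ satisfies the robust strong small-gain condition. (vi) $A$ satisfies the strong small-gain condition.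
   Context: $\mathcal{K}$: continuous strictly increasing $\gamma:\mathbb{R}_+\to\mathbb{R}_+$ with $\gamma(0)=0$; $\mathcal{K}_\infty$: unbounded functions in $\mathcal{K}$. The order on $\mathbb{R}^n$ is componentwise; $A$ monotone means $x\le y\Rightarrow A(x)\le A(y)$ for $x,y\in\mathbb{R}^n_+$. $\mathbf{1}$ is the vector of all ones; $e_i$ is the $i$-th unit vector; $\mathrm{dist}$ is taken in the maximum norm. **Gain operators.** For given $\gamma_{ij}\in\mathcal{K}\cup\{0\}$ ($0$ the zero function), $i,j\in\{1,\dots,n\}$, $\gamma_{ii}=0$: $\Gamma_\otimes(s)=(\max_j\gamma_{ij}(s_j))_{i}$ and $\Gamma_\boxplus(s)=(\sum_j\gamma_{ij}(s_j))_{i}$ for $s\in\mathbb{R}^n_+$. **MLIM.** There is $\xi\in\mathcal{K}_\infty$ such that for every $\varepsilon>0$, every constant input $u(\cdot)\equiv w\in X^+$ and every decreasing solution $x:\mathbb{Z}_+\to X^+$ (a map satisfying the inequality for all $k$, with $x(k+1)\le x(k)$ for all $k$) there is $N\in\mathbb{Z}_+$ (depending on $\varepsilon,u,x(\cdot)$) with $\|x(N)\|\le\varepsilon+\xi(\|w\|)$. **MBI.** There is $\xi\in\mathcal{K}_\infty$ such that for all $v,w\in X^+$: $(\mathrm{id}-A)(v)\le w\Rightarrow\|v\|\le\xi(\|w\|)$. **Strong small-gain condition.** There is $\rho\in\mathcal{K}_\infty$ such that, with $D_\rho(x):=((\mathrm{id}+\rho)(x_i))_i$, one has $D_\rho(A(x))\not\ge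 x$ for all $x\in X^+\setminus\{0\}$. **Robust strong small-gain condition.** There are $\omega,\rho\in\mathcal{K}_\infty$ with $\omega<\mathrm{id}$ (i.e. $\omega(r)<r$ for $r>0$) such that for all $i,j$ the operator $A_{i,j}(x):=A(x)+\omega(x_j)e_i$ satisfies $D_\rho(A_{i,j}(x))\not\ge x$ for all $x\in X^+\setminus\{0\}$ (same $\rho$ for all $i,j$). *)

(* Defs.v *)
From HB Require Import structures.
From mathcomp Require Import all_boot all_order all_algebra.
From mathcomp Require Import all_classical all_reals all_analysis.

Set Implicit Arguments.
Unset Strict Implicit.
Unset Printing Implicit Defensive.

Import Order.TTheory GRing.Theory Num.Theory.
Import numFieldNormedType.Exports.

Local Open Scope classical_set_scope.
Local Open Scope ring_scope.

(* Functions on R_+ (resp. on the cone R^n_+) are represented by total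
   functions on R (resp. on R^n); every condition below, including continuity,
   is restricted to R_+ (resp. R^n_+), so values elsewhere are irrelevant. *)

Section ComparisonFunctions.
Variable R : realType.
Implicit Types g : R -> R.

Definition classK g : Prop :=
  [/\ {within `[0, +oo[, continuous g},
      forall r s, 0 <= r -> r < s -> g r < g s
    & g 0 = 0].

Definition classKinf g : Prop :=
  classK g /\ forall M : R, exists2 r, 0 <= r & M < g r.

Definition classK_or_zero g : Prop :=
  classK g \/ forall r, 0 <= r -> g r = 0.

End ComparisonFunctions.

(* The norm `|x| that MathComp-Analysis puts on 'rV[R]_n is the maximum norm
   (see mx_normrE), and its topology is the Euclidean one. *)

Section OrderedSpace.
Variables (R : realType) (n : nat).
Implicit Types x y : 'rV[R]_n.

Definition vle x y : Prop := forall i : 'I_n, x 0 i <= y 0 i.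

Definition cone : set 'rV[R]_n := [set x | vle 0 x].

Definition dist x (Z : set 'rV[R]_n) : R := inf [set `|x - z| | z in Z].

Definition cone_map (A : 'rV[R]_n -> 'rV[R]_n) : Prop :=
  forall x, cone x -> cone (A x).

Definition cone_monotone (A : 'rV[R]_n -> 'rV[R]_n) : Prop :=
  forall x y, cone x -> cone y -> vle x y -> vle (A x) (A y).

End OrderedSpace.

Section Properties.
Variables (R : realType) (n : nat) (A : 'rV[R]_n -> 'rV[R]_n).

Definition solution (u x : nat -> 'rV[R]_n) : Prop :=
  (forall k, cone (x k)) /\ (forall k, vle (x k.+1) (A (x k) + u k)).

Definition vdecreasing (x : nat -> 'rV[R]_n) : Prop :=
  forall k, vle (x k.+1) (x k).

Definition MLIM : Prop :=
  exists2 xi : R -> R, classKinf xi &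
    forall (eps : R) (w : 'rV[R]_n) (x : nat -> 'rV[R]_n),
      0 < eps -> cone w -> solution (fun=> w) x -> vdecreasing x ->
      exists N : nat, `|x N| <= eps + xi `|w|.

Definition MBI : Prop :=
  exists2 xi : R -> R, classKinf xi &
    forall v w : 'rV[R]_n, cone v -> cone w ->
      vle (v - A v) w -> `|v| <= xi `|w|.

Definition uniform_small_gain : Prop :=
  exists2 eta : R -> R, classKinf eta &
    forall x : 'rV[R]_n, cone x -> eta `|x| <= dist (A x - x) (@cone R n).

Definition shifted_small_gain : Prop :=
  exists2 eta : R -> R, classKinf eta &
    forall x : 'rV[R]_n, cone x -> x != 0 ->
      ~ vle (x - eta `|x| *: const_mx 1) (A x).

Definition Dop (rho : R -> R) (x : 'rV[R]_n) : 'rV[R]_n :=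
  \row_i (x 0 i + rho (x 0 i)).

Definition strong_small_gain : Prop :=
  exists2 rho : R -> R, classKinf rho &
    forall x : 'rV[R]_n, cone x -> x != 0 -> ~ vle x (Dop rho (A x)).

Definition perturbed (omega : R -> R) (i j : 'I_n) (x : 'rV[R]_n) : 'rV[R]_n :=
  A x + omega (x 0 j) *: delta_mx 0 i.

Definition robust_strong_small_gain : Prop :=
  exists omega rho : R -> R,
    [/\ classKinf omega, classKinf rho,
        forall r, 0 < r -> omega r < r
      & forall (i j : 'I_n) (x : 'rV[R]_n), cone x -> x != 0 ->
          ~ vle x (Dop rho (perturbed omega i j x))].

End Properties.

Section GainOperators.
Variables (R : realType) (n : nat) (gamma : 'I_n -> 'I_n -> R -> R).

Definition gains : Prop :=
  (forall i j, classK_or_zero (gamma i j)) /\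
  (forall i r, 0 <= r -> gamma i i r = 0).

(* On the cone all the terms are nonnegative, so for n > 0 the default value 0
   of the iterated maximum does not affect it. *)
Definition gain_max (s : 'rV[R]_n) : 'rV[R]_n :=
  \row_i \big[Num.max/0]_(j < n) gamma i j (s 0 j).

Definition gain_sum (s : 'rV[R]_n) : 'rV[R]_n :=
  \row_i \sum_(j < n) gamma i j (s 0 j).

End GainOperators.

(* Main.v *)
(* MLIM and MBI are equivalent because constant sequences v with v <= A v + w
   are decreasing solutions, while every decreasing solution converges, by
   continuity of A, to such a v. The number max_i (x_i - (A x)_i)^+ is both the
   distance of A x - x to the cone and the smallest norm of a w >= 0 with
   x - A x <= w, so the bounds in MBI and in the uniform small-gain conditions
   are inverse to each other. For gain operators, a margin eta is converted to
   omega = eta / 2 and rho = (eta / 2) o (id + alpha)^-1, where alpha bounds the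
   growth of A; conversely the strong small-gain condition gives MBI by removing
   one index at a time, see [strong_MBI]. *)

Require Import Defs.
From HB Require Import structures.
From mathcomp Require Import all_boot all_order all_algebra.
From mathcomp Require Import all_classical all_reals all_analysis.
From mathcomp Require Import lra.

Import Order.TTheory GRing.Theory Num.Theory.
Import numFieldNormedType.Exports.

Local Open Scope classical_set_scope.
Local Open Scope ring_scope.

(** * Comparison functions on the half-line: sums, compositions, inverses *)

Section ComparisonFunctions.
Context {R : realType}.
Implicit Types (f g h : R -> R) (r s : R).

(* Precomposition with [pos] turns continuity on the half-line into continuity
   on R, where it is stable under the usual operations. *)
Definition pos r : R := Num.max 0 r.

Lemma pos_ge0 r : 0 <= pos r.
Proof. by rewrite le_max lexx. Qed.

Lemma pos_id r : 0 <= r -> pos r = r.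
Proof. by move=> r0; apply/max_idPr. Qed.

Lemma continuous_pos : continuous pos.
Proof.
move=> x; apply: (@continuous_max R R (fun=> 0) id x).
  exact: cst_continuous.
exact: cvg_id.
Qed.

Lemma within_continuous_pos g :
  {within `[0, +oo[, continuous g} <-> continuous (g \o pos).
Proof.
split=> [/subspace_continuousP gc x|gc].
  apply: (cvg_comp pos g) (gc (pos x) _); last first.
    by rewrite /= in_itv /= pos_ge0.
  move=> P wP; apply: (@filterS _ (nbhs x)) (continuous_pos x _ wP) => y /=.
  by apply; rewrite /= in_itv /= pos_ge0.
apply: (@subspace_eq_continuous _ _ _ (g \o pos : subspace _ -> R)).
  by move=> x; rewrite inE /= in_itv /= andbT => x0; rewrite pos_id.
exact: continuous_subspaceT.
Qed.

(** Class K relaxed to nondecreasing functions, so that zero gains are included and finite sums of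
    gains stay in the class. *)
Definition weakK g : Prop :=
  [/\ {within `[0, +oo[, continuous g},
      forall r s, 0 <= r -> r <= s -> g r <= g s & g 0 = 0].

Lemma weakK_ge0 {g} {r} : weakK g -> 0 <= r -> 0 <= g r.
Proof. by move=> [_ gle g0] r0; rewrite -g0 gle. Qed.

Lemma weakK_ext g h : (forall r, 0 <= r -> g r = h r) -> weakK g -> weakK h.
Proof.
move=> gh [gc gle g0]; split; last by rewrite -gh.
  apply: (@subspace_eq_continuous _ _ _ (g : subspace _ -> R)) gc => x.
  by rewrite inE /= in_itv /= andbT => /gh.
by move=> r s r0 rs; rewrite -!gh// ?gle// (le_trans r0).
Qed.

Lemma weakK0 : weakK (fun=> 0).
Proof. by split=> //; apply/within_continuous_pos; exact: cst_continuous. Qed.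

Lemma weakK_add g h : weakK g -> weakK h -> weakK (fun r => g r + h r).
Proof.
move=> [gc gle g0] [hc hle h0]; split; last by rewrite g0 h0 addr0.
  apply/within_continuous_pos => x.
  apply: (@cvgD _ _ _ _ _ (g \o pos) (h \o pos)).
    exact: (within_continuous_pos g).1.
  exact: (within_continuous_pos h).1.
by move=> r s r0 rs; rewrite lerD ?gle ?hle.
Qed.

Lemma weakK_sum (I : Type) (l : seq I) (P : pred I) (F : I -> R -> R) :
  (forall i, P i -> weakK (F i)) -> weakK (fun r => \sum_(i <- l | P i) F i r).
Proof.
move=> FK; elim: l => [|i l IH].
  by apply: weakK_ext weakK0 => r _; rewrite big_nil.
have [Pi|nPi] := boolP (P i); last first.
  by apply: weakK_ext IH => r _; rewrite big_cons (negPf nPi).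
by apply: weakK_ext (weakK_add _ _ (FK i Pi) IH) => r _; rewrite big_cons Pi.
Qed.

Lemma classK_weakK g : classK g -> weakK g.
Proof.
move=> [gc glt g0]; split=> // r s r0.
by rewrite le_eqVlt => /predU1P[->//|rs]; rewrite ltW// glt.
Qed.

Lemma classKinf_weakK g : classKinf g -> weakK g.
Proof. by move=> [/classK_weakK]. Qed.

Lemma classK_or_zero_weakK g : classK_or_zero g -> weakK g.
Proof.
move=> [/classK_weakK//|g0]; apply: weakK_ext weakK0 => r r0; by rewrite g0.
Qed.

Lemma classKinf_gt0 {g} {r} : classKinf g -> 0 < r -> 0 < g r.
Proof. by move=> [[_ glt g0] _] r0; rewrite -g0 glt. Qed.

Lemma classKinf_le {g} {r s} : classKinf g -> 0 <= r -> 0 <= s ->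
  (g r <= g s) = (r <= s).
Proof.
move=> gK r0 s0; have [_ gle _] := classKinf_weakK _ gK.
have [[_ glt _] _] := gK.
have [rs|sr] := leP r s; first by rewrite gle.
by apply/negbTE; rewrite -ltNge glt.
Qed.

Lemma classKinf_lt {g} {r s} : classKinf g -> 0 <= r -> 0 <= s ->
  (g r < g s) = (r < s).
Proof. by move=> gK r0 s0; rewrite !ltNge (classKinf_le gK). Qed.

Lemma classKinf_id : classKinf (id : R -> R).
Proof.
split=> [|M]; first by split=> //; apply/within_continuous_pos/continuous_pos.
by exists (pos M + 1); [rewrite addr_ge0 ?pos_ge0|
  rewrite (le_lt_trans (y := pos M)) ?ltrDl// le_max lexx orbT].
Qed.

(** One summand already supplies strictness and unboundedness. This covers [id + alpha] when [alpha]
    comes from gains that may vanish. *)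
Lemma classKinf_add g h : classKinf g -> weakK h ->
  classKinf (fun r => g r + h r).
Proof.
move=> gK hK; have [hc hle h0] := hK; have [[gc glt g0] gM] := gK.
have [ghc _ gh0] := weakK_add _ _ (classKinf_weakK _ gK) hK.
split=> [|M].
  by split=> // r s r0 rs; rewrite ltr_leD ?glt ?hle// ltW.
have [r r0 Mr] := gM M; exists r => //.
by rewrite (lt_le_trans Mr)// lerDl (weakK_ge0 hK).
Qed.

Lemma classKinf_scale (c : R) g : 0 < c -> classKinf g ->
  classKinf (fun r => c * g r).
Proof.
move=> c0 [[gc glt g0] gM]; split=> [|M].
  split; last by rewrite g0 mulr0.
    apply/within_continuous_pos => x.
    apply: (@cvgM _ _ _ _ (fun=> c) (g \o pos)); first exact: cvg_cst.
    exact: (within_continuous_pos g).1.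
  by move=> r s r0 rs; rewrite ltr_pM2l// glt.
have [r r0 Mr] := gM (M / c); exists r => //.
by rewrite mulrC -ltr_pdivrMr.
Qed.

Lemma classKinf_comp g h : classKinf g -> classKinf h -> classKinf (g \o h).
Proof.
move=> gK hK; have [[gc glt g0] gM] := gK; have [[hc hlt h0] hM] := hK.
have h_ge0 r : 0 <= r -> 0 <= h r by apply/weakK_ge0/classKinf_weakK.
split=> [|M].
  split=> /=; last by rewrite h0 g0.
    apply/within_continuous_pos => x.
    (* The extra inner [pos] is harmless because [h] is nonnegative on the half-line. *)
    have -> : g \o h \o pos = (g \o pos) \o (h \o pos).
      by apply/funext => y /=; rewrite (pos_id (h _))// h_ge0// pos_ge0.
    apply: continuous_comp; first exact: (within_continuous_pos h).1.
    exact: (within_continuous_pos g).1.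
  by move=> r s r0 rs; rewrite glt ?hlt ?h_ge0.
have [r r0 Mr] := gM M; have [s s0 rs] := hM r; exists s => //=.
by rewrite (lt_trans Mr)// glt.
Qed.

Lemma classKinf_iter n g : classKinf g -> classKinf (iter n g).
Proof.
by move=> gK; elim: n => [|n IH]; [exact: classKinf_id|exact: classKinf_comp].
Qed.

Lemma classKinf_surj g s : classKinf g -> 0 <= s -> exists2 r, 0 <= r & g r = s.
Proof.
move=> gK s0; have [[gc glt g0] gM] := gK.
have [b b0 sb] := gM s.
have [||r rb <-] := @IVT R g 0 b s b0.
- by apply: continuous_subspaceW gc => x /=; rewrite !in_itv /= => /andP[->].
- by rewrite g0 ge_min le_max s0 (ltW sb) orbT.
- by exists r => //; move: rb; rewrite in_itv => /andP[].
Qed.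

(** Surjectivity yields the inverse by choice. It is continuous because [g] is strictly increasing:
    [h y] lies within [e] of [h x] as soon as [y] lies between the values of [g] at [h x - e] and
    [h x + e]. *)
Lemma classKinf_inv g : classKinf g ->
  exists2 h, classKinf h &
    forall r, 0 <= r -> [/\ 0 <= h r, g (h r) = r & h (g r) = r].
Proof.
move=> gK; have [[gc glt g0] gM] := gK.
have /choice[h hP] s : exists r, 0 <= s -> 0 <= r /\ g r = s.
  have [s0|s0] := leP 0 s; last by exists 0.
  by have [r ? ?] := classKinf_surj _ _ gK s0; exists r.
have h_ge0 r : 0 <= r -> 0 <= h r by move=> /hP[].
have gh r : 0 <= r -> g (h r) = r by move=> /hP[].
have g_ge0 r : 0 <= r -> 0 <= g r by apply/weakK_ge0/classKinf_weakK.
have hg r : 0 <= r -> h (g r) = r.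
  move=> r0; have hgr0 := h_ge0 _ (g_ge0 _ r0); apply: le_anti.
  rewrite -(classKinf_le gK hgr0 r0) -(classKinf_le gK r0 hgr0).
  by rewrite gh ?g_ge0 ?lexx.
exists h; last by move=> r r0; rewrite h_ge0 ?gh ?hg.
have hlt r s : 0 <= r -> r < s -> h r < h s.
  move=> r0 rs; have s0 : 0 <= s by rewrite (le_trans r0)// ltW.
  by rewrite -(classKinf_lt gK) ?h_ge0// !gh.
split=> [|M].
  split=> //; last by have := hg 0 (lexx 0); rewrite g0.
  apply/within_continuous_pos => x; apply/cvgrPdist_lt => e e0 /=.
  have hx := gh _ (pos_ge0 x).
  have a0 : 0 <= h (pos x) + e by rewrite addr_ge0 ?h_ge0 ?pos_ge0// ltW.
  have hi : \forall y \near x, pos y < g (h (pos x) + e).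
    apply: (@cvgr_lt R R (nbhs x) _ pos (pos x) (continuous_pos x)).
    by rewrite -[ltLHS]hx (classKinf_lt gK) ?h_ge0 ?pos_ge0// ltrDl.
  have lo : \forall y \near x, h (pos x) - e < h (pos y).
    (* Nothing is known of [g] at negative arguments; there [0 <= h] gives the lower bound
       directly. *)
    have [b0|b0] := ltP (h (pos x) - e) 0.
      apply: (@filterE _ (nbhs x)) => y.
      by rewrite (lt_le_trans b0)// h_ge0// pos_ge0.
    have : \forall y \near x, g (h (pos x) - e) < pos y.
      apply: (@cvgr_gt R R (nbhs x) _ pos (pos x) (continuous_pos x)).
      by rewrite -[ltRHS]hx (classKinf_lt gK) ?h_ge0 ?pos_ge0// gtrDl oppr_lt0.
    apply: (@filterS _ (nbhs x)) => y ylt.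
    by rewrite -(classKinf_lt gK) ?h_ge0 ?pos_ge0// gh ?pos_ge0.
  near=> y; rewrite ltr_distlC; apply/andP; split; first by near: y.
  rewrite -(classKinf_lt gK) ?h_ge0 ?pos_ge0// gh ?pos_ge0//.
  by near: y.
exists (g (pos M + 1)); first by rewrite g_ge0// addr_ge0 ?pos_ge0.
rewrite hg ?addr_ge0 ?pos_ge0// (le_lt_trans (y := pos M)) ?ltrDl//.
by rewrite le_max lexx orbT.
Unshelve. all: by end_near.
Qed.

End ComparisonFunctions.

(** * Maximum norm, cone and coordinatewise convergence *)

Section RowVectors.
Context {R : realType} {n : nat}.
Implicit Types (x y : 'rV[R]_n) (c : R).

Lemma coord_le_norm x i : `|x 0 i| <= `|x|.
Proof.
rewrite /Num.Def.normr /= mx_normrE.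
exact: (le_bigmax_cond _ (fun ij => `|x ij.1 ij.2|) (j := (0, i))).
Qed.

Lemma norm_le_coord x c : 0 <= c -> (forall i, `|x 0 i| <= c) -> `|x| <= c.
Proof.
move=> c0 xc; rewrite /Num.Def.normr /= mx_normrE.
by apply: bigmax_le => // -[i j] _ /=; rewrite ord1.
Qed.

Lemma cone_ge0 x i : cone x -> 0 <= x 0 i.
Proof. by move=> /(_ i); rewrite mxE. Qed.

Lemma entry_le_norm x i : x 0 i <= `|x|.
Proof. by rewrite (le_trans (ler_norm _))// coord_le_norm. Qed.

Lemma cone_norm_le x c : cone x -> 0 <= c -> (forall i, x 0 i <= c) ->
  `|x| <= c.
Proof.
by move=> x0 c0 xc; apply: norm_le_coord => // i; rewrite ger0_norm ?cone_ge0.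
Qed.

Lemma not_vle x y : ~ vle x y -> exists i, y 0 i < x 0 i.
Proof.
move=> xy; apply: contrapT => yx; apply: xy => i; rewrite leNgt.
by apply/negP => yxi; apply: yx; exists i.
Qed.

Lemma cvg_rowP (u : nat -> 'rV[R]_n) x :
  (forall i, u k 0 i @[k --> \oo] --> x 0 i) -> u k @[k --> \oo] --> x.
Proof.
move=> ux; apply/cvgrPdist_le => e e0 /=.
have : \forall k \near \oo, forall i, `|x 0 i - u k 0 i| <= e.
  by apply: filter_forall => i; move/cvgrPdist_le: (ux i); exact.
apply: filterS => k uk; apply: norm_le_coord => [|i]; first exact: ltW.
by rewrite !mxE uk.
Qed.

End RowVectors.

(** * The equivalences valid for every continuous monotone operator *)

Section Equivalences.
Context {R : realType} {n : nat}.
Variable A : 'rV[R]_n -> 'rV[R]_n.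

Lemma MLIM_MBI : MLIM A -> MBI A.
Proof.
move=> [xi xiK xiP]; exists xi => // v w v0 w0 vw.
apply/ler_addgt0Pl => e e0.
have [||//] := xiP e w (fun=> v) e0 w0; last by move=> k i.
by split=> // k i; have := vw i; rewrite !mxE; lra.
Qed.

Lemma MBI_MLIM : {within @cone R n, continuous A} -> MBI A -> MLIM A.
Proof.
move=> /subspace_continuousP Ac [xi xiK xiP].
exists xi => // eps w x eps0 w0 [x0 xA] xdecr.
have xi_decr i : nonincreasing_seq (fun k => x k 0 i).
  by apply/nonincreasing_seqP => k; exact: xdecr.
have xi_cvg i : cvgn (fun k => x k 0 i).
  apply: nonincreasing_is_cvgn => //; exists 0 => _ [k _ <-].
  exact/cone_ge0/x0.
pose l : 'rV[R]_n := \row_i limn (fun k => x k 0 i).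
have xl : x k @[k --> \oo] --> l.
  by apply: cvg_rowP => i; rewrite mxE; exact: xi_cvg.
have l_le k i : l 0 i <= x k 0 i.
  by rewrite mxE; exact: (nonincreasing_cvgn_ge (xi_decr i) (xi_cvg i)).
have l0 : cone l.
  move=> i; rewrite !mxE; apply: limr_ge; first exact: xi_cvg.
  by apply: nearW => k; exact/cone_ge0/x0.
have Axl : A (x k) @[k --> \oo] --> A l.
  apply: (cvg_comp x A) (Ac _ l0) => P /xl; rewrite /nbhs /=.
  by apply: filterS => k; apply; exact: x0.
(* Pass to the limit in [l <= x (k+1) <= A (x k) + w]. *)
have Alw : vle (l - A l) w.
  move=> i; rewrite !mxE -/(l 0 i).
  suff : l 0 i - w 0 i <= A l 0 i by rewrite mxE; lra.
  have Axli : A (x k) 0 i @[k --> \oo] --> A l 0 i.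
    apply: (cvg_comp _ (fun M : 'rV[R]_n => M 0 i) Axl).
    exact: coord_continuous.
  apply: (cvgr_to_ge Axli); apply: nearW => k.
  by have := xA k i; have := l_le k.+1 i; rewrite !mxE; lra.
move/cvgrPdist_le: xl => /(_ eps eps0)[N _ /(_ N (leqnn N))] /= lN.
exists N; rewrite -[x N](subKr l) (le_trans (ler_normB _ _))// addrC lerD//.
exact: xiP.
Qed.

Lemma MBI_USG : MBI A -> uniform_small_gain A.
Proof.
move=> [xi xiK xiP]; have [h hK hP] := classKinf_inv _ xiK.
exists h => // x x0; apply: lb_le_inf.
  by exists `|A x - x - 0|, 0 => // i; rewrite lexx.
move=> _ [z z0 <-].
(* Since [z >= 0], each entry of [x - A x] is at most the norm of [A x - x - z], so MBI applies with
   this constant vector. *)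
pose w : 'rV[R]_n := const_mx `|A x - x - z|.
have w0 : cone w by move=> i; rewrite !mxE.
have xw : vle (x - A x) w.
  move=> i; have := coord_le_norm (A x - x - z) i.
  rewrite !mxE ler_norml => /andP[+ _]; have := cone_ge0 _ i z0.
  by move: `|A x - x - z| => c; lra.
have wn : `|w| <= `|A x - x - z|.
  by apply: cone_norm_le => // i; rewrite mxE.
have [hx0 xih _] := hP _ (normr_ge0 x).
rewrite (le_trans _ wn)// -(classKinf_le xiK)// xih.
exact: xiP.
Qed.

(** If [A x >= x - c 1], then shifting [A x - x] by [c 1] lands in the cone, so the distance is at
    most [c]. Halving [eta] makes this a strict contradiction. *)
Lemma USG_SSG : uniform_small_gain A -> shifted_small_gain A.
Proof.
move=> [eta etaK etaP]; exists (fun r => 2^-1 * eta r).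
  by apply: classKinf_scale => //; rewrite invr_gt0.
move=> x x0 xn0 xA; have := etaP x x0; apply/negP; rewrite -ltNge.
have eta0 : 0 < eta `|x| by apply: (classKinf_gt0 etaK); rewrite normr_gt0.
set c := 2^-1 * eta `|x|; have c0 : 0 <= c by rewrite mulr_ge0// ltW.
apply: (@le_lt_trans _ _ c); last by rewrite /c; lra.
pose z := A x - x + c *: const_mx 1.
have zcone : cone z by move=> i; have := xA i; rewrite !mxE -/c; lra.
apply: (@le_trans _ _ `|A x - x - z|).
  by apply: ge_inf; [exists 0 => _ [y _ <-]|exists z].
rewrite /z opprD addrA subrr sub0r normrN; apply: norm_le_coord => // i.
by rewrite !mxE mulr1 ger0_norm.
Qed.

Lemma SSG_MBI : shifted_small_gain A -> MBI A.
Proof.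
move=> [eta etaK etaP]; have [h hK hP] := classKinf_inv _ etaK.
exists h => // v w v0 w0 vw.
have [hw0 etah _] := hP _ (normr_ge0 w).
have [->|vn0] := eqVneq v 0; first by rewrite normr0.
(* Otherwise [|w| < eta |v|], and [A v >= v - w >= v - eta |v| 1] violates the condition. *)
rewrite leNgt -(classKinf_lt etaK)// etah; apply/negP => wv.
apply: (etaP v) => // i; have := vw i; have := entry_le_norm w i.
by rewrite !mxE; lra.
Qed.

End Equivalences.

(** * Gain operators and the strong small-gain conditions *)

Section GainOperators.
Context {R : realType} {n : nat}.
Implicit Types (v w x : 'rV[R]_n) (I : {set 'I_n}) (A : 'rV[R]_n -> 'rV[R]_n).

Definition restrict I v : 'rV[R]_n := \row_j (if j \in I then v 0 j else 0).

Lemma restrict_cone I v : cone v -> cone (restrict I v).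
Proof. by move=> v0 j; rewrite !mxE; case: ifP => // _; exact: cone_ge0. Qed.

(* The only property of gain operators that matters: coordinates of size at
   most [b] can be dropped at the cost of an additive error [alpha b]. *)
Definition truncation_bound A (alpha : R -> R) : Prop :=
  forall I v b i, cone v -> 0 <= b -> (forall j, j \notin I -> v 0 j <= b) ->
    A v 0 i <= A (restrict I v) 0 i + alpha b.

Section Gains.
Variable gamma : 'I_n -> 'I_n -> R -> R.
Hypothesis gammaP : gains gamma.

(** Summing over all rows gives one error bound [alpha] that serves every coordinate. *)
Definition total_gain (r : R) : R := \sum_i \sum_j gamma i j r.

Let gammaK i j : weakK (gamma i j).
Proof. by apply: classK_or_zero_weakK; have [] := gammaP. Qed.

Lemma weakK_total_gain : weakK total_gain.
Proof. by apply: weakK_sum => i _; apply: weakK_sum => j _; exact: gammaK. Qed.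

Lemma row_gain_le_total i r : 0 <= r -> \sum_j gamma i j r <= total_gain r.
Proof.
move=> r0; rewrite /total_gain [leRHS](bigD1 i)//= lerDl.
by apply: sumr_ge0 => k _; apply: sumr_ge0 => j _; exact: weakK_ge0.
Qed.

Lemma gain_restrict_le I v b i j : cone v -> 0 <= b ->
  (forall k, k \notin I -> v 0 k <= b) ->
  gamma i j (v 0 j) <= gamma i j (restrict I v 0 j) + gamma i j b.
Proof.
move=> v0 b0 vb; rewrite mxE; have [_ gle g0] := gammaK i j.
case: ifPn => [_|/vb vjb]; first by rewrite lerDl (weakK_ge0 (gammaK i j)).
by rewrite g0 add0r gle// cone_ge0.
Qed.

Lemma gain_sum_truncation : truncation_bound (gain_sum gamma) total_gain.
Proof.
move=> I v b i v0 b0 vb; rewrite !mxE.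
apply: le_trans (_ : _ <= \sum_j gamma i j (restrict I v 0 j) +
                          \sum_j gamma i j b) _.
  by rewrite -big_split; apply: ler_sum => j _; exact: gain_restrict_le.
by rewrite lerD2l row_gain_le_total.
Qed.

Lemma gain_max_truncation : truncation_bound (gain_max gamma) total_gain.
Proof.
move=> I v b i v0 b0 vb; rewrite !mxE.
have total0 := weakK_ge0 weakK_total_gain b0.
(* The default value 0 of the maximum also has to be bounded. *)
apply: bigmax_le => [|j _]; first by rewrite addr_ge0// bigmax_idl le_max lexx.
rewrite (le_trans (gain_restrict_le _ _ _ i j v0 b0 vb))// lerD//.
  exact: (le_bigmax_cond _ (fun k => gamma i k (restrict I v 0 k))).
rewrite (le_trans _ (row_gain_le_total i _ b0))// (bigD1 j)//= lerDl.
by apply: sumr_ge0 => k _; exact: (weakK_ge0 (gammaK _ _)).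
Qed.

Lemma gain_sum0 : gain_sum gamma 0 = 0.
Proof.
apply/rowP => i; rewrite !mxE big1// => j _; rewrite mxE.
by have [] := gammaK i j.
Qed.

Lemma gain_max0 : gain_max gamma 0 = 0.
Proof.
apply/rowP => i; rewrite !mxE; apply: big1_idem; first exact: maxxx.
by move=> j _; rewrite mxE; have [] := gammaK i j.
Qed.

End Gains.

Lemma restrict_set0 v : restrict finset.set0 v = 0.
Proof. by apply/rowP => j; rewrite !mxE inE. Qed.

(** Drop all coordinates at once, with [b = |x|]. *)
Lemma truncation_bound_norm {A alpha} : truncation_bound A alpha -> A 0 = 0 ->
  forall x i, cone x -> A x 0 i <= alpha `|x|.
Proof.
move=> AP A0 x i x0.
have := AP finset.set0 x `|x| i x0 (normr_ge0 x) (fun j _ => entry_le_norm x j).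
by rewrite restrict_set0 A0 mxE add0r.
Qed.

(** The margin [eta] is split in two halves: one pays for the perturbation, the other for [rho],
    whose argument is at most [beta |x|]. *)
Lemma SSG_robust A alpha : (0 < n)%N -> cone_map A -> A 0 = 0 ->
  weakK alpha -> truncation_bound A alpha ->
  shifted_small_gain A -> robust_strong_small_gain A.
Proof.
move=> n_gt0 Acone A0 alphaK AP [eta etaK etaP].
pose beta r := r + alpha r.
have betaK : classKinf beta by apply: classKinf_add alphaK; exact: classKinf_id.
have [h hK hP] := classKinf_inv _ betaK.
pose omega r := 2^-1 * eta r.
have omegaK : classKinf omega by apply: classKinf_scale => //; rewrite invr_gt0.
have omega_ge0 r : 0 <= r -> 0 <= omega r.
  by apply/weakK_ge0/classKinf_weakK.
have omega_lt r : 0 < r -> omega r < r.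
  (* At [x = r 1] some coordinate satisfies [0 <= (A x)_i < r - eta r], hence [eta r < r]. *)
  move=> r0; pose x : 'rV[R]_n := const_mx r.
  have x0 : cone x by move=> i; rewrite !mxE ltW.
  have xr : `|x| = r.
    apply: le_anti; have := entry_le_norm x (Ordinal n_gt0).
    by rewrite mxE => ->; rewrite cone_norm_le ?ltW// => i; rewrite mxE.
  have xn0 : x != 0 by rewrite -normr_gt0 xr.
  have [i] := not_vle _ _ (etaP x x0 xn0).
  have := cone_ge0 _ i (Acone x x0); have := classKinf_gt0 etaK r0.
  by rewrite /omega !mxE xr; lra.
exists omega, (omega \o h); split=> //; first exact: classKinf_comp.
move=> i j x x0 xn0 xP.
have [k] := not_vle _ _ (etaP x x0 xn0); have := xP k.
have nx0 : 0 < `|x| by rewrite normr_gt0.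
have := truncation_bound_norm AP A0 x k x0; have := cone_ge0 _ k (Acone x x0).
rewrite /Dop /perturbed; set y := A x + _.
have yAx : A x 0 k <= y 0 k <= A x 0 k + omega `|x|.
  have xj0 := cone_ge0 _ j x0.
  rewrite !mxE eqxx lerDl lerD2l; case: (k == i) => /=.
    by rewrite mulr1n mulr1 omega_ge0// (classKinf_le omegaK) ?entry_le_norm.
  by rewrite mulr0n mulr0 lexx omega_ge0.
move: (A x 0 k) y yAx => a y /andP[ay ya] a0 aalpha.
have ybeta : y 0 k <= beta `|x|.
  by rewrite /beta; have := omega_lt _ nx0; lra.
have : omega (h (y 0 k)) <= omega `|x|.
  have [_ _ hb] := hP _ (normr_ge0 x).
  have y0 : 0 <= y 0 k by lra.
  have [hy0 _ _] := hP _ y0.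
  rewrite (classKinf_le omegaK)// -hb (classKinf_le hK)//.
  by rewrite (weakK_ge0 (classKinf_weakK _ betaK)).
have eta2 : eta `|x| = omega `|x| + omega `|x| by rewrite /omega; lra.
by rewrite !mxE /= eta2; lra.
Qed.

(** The perturbation only increases [A], and [D_rho] is monotone on the cone, so a single pair of
    indices suffices. *)
Lemma robust_strong A : (0 < n)%N -> cone_map A ->
  robust_strong_small_gain A -> strong_small_gain A.
Proof.
move=> n_gt0 Acone [omega [rho [omegaK rhoK _ AP]]]; exists rho => // x x0 xn0.
move=> xA; pose i := Ordinal n_gt0; apply: (AP i i x x0 xn0) => k.
apply: (le_trans (xA k)).
have Ak0 := cone_ge0 _ k (Acone x x0).
have om0 : 0 <= omega (x 0 i).
  by rewrite (weakK_ge0 (classKinf_weakK _ omegaK))// cone_ge0.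
have Ay : A x 0 k <= perturbed A omega i i x 0 k.
  by rewrite !mxE lerDl mulr_ge0// ler0n.
have DopE z : Dop rho z 0 k = z 0 k + rho (z 0 k) by rewrite mxE.
by rewrite !DopE lerD// (classKinf_le rhoK)// (le_trans Ak0).
Qed.

(* If v <= A v + w and v is at most b off I, the strong small-gain condition at
   the truncation of v to I provides an index i in I with v_i <= G b, where
   G r = r + rho^-1 (r + alpha r) + r + alpha r. So i can be removed from I at
   the cost of replacing b by G b, and starting from the full index set with
   b = |w|, all indices are removed after n steps. *)
Lemma strong_MBI A alpha : cone_map A -> weakK alpha ->
  truncation_bound A alpha -> strong_small_gain A -> MBI A.
Proof.
move=> Acone alphaK AP [rho rhoK rhoP].
have [h hK hP] := classKinf_inv _ rhoK.
pose beta r := r + alpha r.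
have betaK : classKinf beta by apply: classKinf_add alphaK; exact: classKinf_id.
pose G r := r + (h (beta r) + beta r).
have GK : classKinf G.
  apply: classKinf_add; first exact: classKinf_id.
  apply: weakK_add; last exact: classKinf_weakK.
  by apply/classKinf_weakK/(classKinf_comp _ _ hK betaK).
have beta_ge0 r : 0 <= r -> 0 <= beta r by apply/weakK_ge0/classKinf_weakK.
have hbeta_ge0 r : 0 <= r -> 0 <= h (beta r) by move=> /beta_ge0/hP[].
have G_ge r : 0 <= r -> r <= G r.
  by move=> r0; rewrite lerDl addr_ge0 ?beta_ge0 ?hbeta_ge0.
have iterG_ge k r : 0 <= r -> r <= iter k G r.
  move=> r0; elim: k => //= k rk; rewrite (le_trans rk)// G_ge//.
  exact: le_trans rk.
exists (iter n G); first exact: classKinf_iter.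
move=> v w v0 w0 vw.
suff main k I b : (#|I| <= k)%N -> `|w| <= b ->
    (forall j, j \notin I -> v 0 j <= b) -> `|v| <= iter k G b.
  by apply: (main _ finset.setT) => // [|j]; rewrite ?cardsT ?card_ord// inE.
elim: k I b => [|k IH] I b cardI wb vb;
  have b0 : 0 <= b := le_trans (normr_ge0 w) wb.
  move: cardI; rewrite leqn0 cards_eq0 => /eqP I0.
  by apply: cone_norm_le => // i; apply: vb; rewrite I0 inE.
have [vI0|vIn0] := eqVneq (restrict I v) 0.
  apply: le_trans (iterG_ge k.+1 b b0).
  apply: cone_norm_le => // i.
  have [iI|/vb//] := boolP (i \in I).
  by move/rowP/(_ i): vI0; rewrite !mxE iI => ->.
have vIcone := restrict_cone I _ v0.
have [i] := not_vle _ _ (rhoP _ vIcone vIn0).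
have a0 := cone_ge0 _ i (Acone _ vIcone).
have rho_ge0 := weakK_ge0 (classKinf_weakK _ rhoK) a0.
(* Off [I] the truncated entry is 0 and cannot exceed a nonnegative number, so [i] lies in [I]. *)
rewrite !mxE; case: ifPn => [iI|_]; last by rewrite ltNge addr_ge0.
have := AP I v b i v0 b0 vb; have := vw i; rewrite !mxE.
have := entry_le_norm w i.
move: (A (restrict I v) 0 i) a0 rho_ge0 => a a0 rho_ge0 wi vwi Avi avi.
(* Combining [a + rho a < v_i] with [v_i <= a + alpha b + w_i] gives [rho a < beta b]. *)
have abeta : a <= h (beta b).
  have [hb0 rhob _] := hP _ (beta_ge0 _ b0).
  by rewrite -(classKinf_le rhoK)// rhob /beta; lra.
have viG : v 0 i <= G b by rewrite /G /beta in abeta *; lra.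
rewrite iterSr; apply: (IH (I :\ i)).
- by move: cardI; rewrite (cardsD1 i I) iI.
- exact: le_trans wb (G_ge _ b0).
- move=> j; rewrite !inE negb_and negbK => /orP[/eqP->//|/vb vjb].
  exact: le_trans vjb (G_ge _ b0).
Qed.

End GainOperators.

(** * Assembly of the two cycles of implications *)

Theorem proposition7p12 (R : realType) (n : nat) (n_gt0 : (0 < n)%N)
    (A : 'rV[R]_n -> 'rV[R]_n)
    (A_cone : cone_map A)
    (A_cont : {within @cone R n, continuous A})
    (A_mono : cone_monotone A) :
  [<-> MLIM A; MBI A; uniform_small_gain A; shifted_small_gain A]
  /\
  (forall gamma : 'I_n -> 'I_n -> R -> R, gains gamma ->
     (forall s, cone s -> A s = gain_sum gamma s) \/
     (forall s, cone s -> A s = gain_max gamma s) ->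
     [<-> MLIM A; MBI A; uniform_small_gain A; shifted_small_gain A;
          robust_strong_small_gain A; strong_small_gain A]).
Proof.
have MBI_MLIM := @MBI_MLIM _ _ A A_cont.
split.
  tfae; [exact: MLIM_MBI|exact: MBI_USG|exact: USG_SSG|].
  by move/SSG_MBI/MBI_MLIM.
move=> gamma gammaP AE.
have alphaK := weakK_total_gain _ gammaP.
have cone0 : cone (0 : 'rV[R]_n) by move=> i.
(* [A] agrees with the gain operator only on the cone, which contains 0 and the truncations of its
   elements. *)
have [A0 AP] : A 0 = 0 /\ truncation_bound A (total_gain gamma).
  case: AE => AE; split; rewrite ?AE ?gain_sum0 ?gain_max0//.
    move=> I v b i v0; rewrite !AE//; last exact: restrict_cone.
    exact: gain_sum_truncation.
  move=> I v b i v0; rewrite !AE//; last exact: restrict_cone.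
  exact: gain_max_truncation.
tfae; [exact: MLIM_MBI|exact: MBI_USG|exact: USG_SSG| | |].
- exact: SSG_robust alphaK AP.
- exact: robust_strong.
- by move/(strong_MBI _ _ A_cone alphaK AP)/MBI_MLIM.
Qed.
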